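(* Let $a$ and $b$ be real numbers with $a>0$ and $b>a+2$. Then there is no positive integer $n$ that is a strong alpha number of order $(a,b)$.
   Context: For a positive integer $n$ and real $x$, $\sigma_x(n)=\sum_{d\mid n} d^x$; $\omega(n)$ is the number of distinct prime divisors of $n$. A positive integer $n$ is a strong alpha number of order $(a,b)$ if there exist coprime positive integers $\alpha_1,\alpha_2$ with $\sigma_a(n)=\frac{\alpha_1}{\alpha_2}n^{b}$ and $2\le \max(\alpha_1,\alpha_2)\le \omega(n)$. *)

(* Defs.v *)
From HB Require Import structures.
From mathcomp Require Import all_boot all_order all_algebra.
From mathcomp Require Import reals exp.

Set Implicit Arguments.
Unset Strict Implicit.
Unset Printing Implicit Defensive.

Import Order.TTheory GRing.Theory Num.Theory.
Local Open Scope ring_scope.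

Definition sigma (R : realType) (x : R) (n : nat) : R :=
  \sum_(d <- divisors n) d%:R `^ x.

Definition omega (n : nat) : nat := size (primes n).

Definition strong_alpha (R : realType) (a b : R) (n : nat) : Prop :=
  (0 < n)%N /\
  exists alpha1 alpha2 : nat,
    [/\ (0 < alpha1)%N, (0 < alpha2)%N, coprime alpha1 alpha2,
        sigma a n = alpha1%:R / alpha2%:R * n%:R `^ b
      & (2 <= maxn alpha1 alpha2 <= omega n)%N].

(* Main.v *)
Require Import Defs.
From HB Require Import structures.
From mathcomp Require Import all_boot all_order all_algebra.
From mathcomp Require Import reals exp.

Import Order.TTheory GRing.Theory Num.Theory.
Local Open Scope ring_scope.

(** Each of the at most [n] divisors of [n] contributes at most [n ^ a] to
    [sigma a n], and [alpha2 <= omega n <= n]; hence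
    [n ^ b <= alpha1 * n ^ b = alpha2 * sigma a n <= n ^ (a + 2)], which is
    impossible when [n > 1] and [b > a + 2]. *)

Lemma size_divisors_le (n : nat) : (0 < n)%N -> (size (divisors n) <= n)%N.
Proof.
move=> n0; rewrite -[leqRHS](size_iota 1 n).
apply: uniq_leq_size (divisors_uniq n) _ => d.
rewrite -dvdn_divisors // mem_iota add1n ltnS => dn.
by rewrite (dvdn_gt0 n0 dn) dvdn_leq.
Qed.

Lemma omega_le (n : nat) : (omega n <= n)%N.
Proof.
rewrite -[leqRHS](size_iota 1 n).
apply: uniq_leq_size (primes_uniq n) _ => p.
rewrite mem_primes mem_iota add1n ltnS => /and3P[/prime_gt0 -> n0 pn].
by rewrite dvdn_leq.
Qed.

Lemma sigma_le (R : realType) (a : R) (n : nat) : 0 <= a -> (0 < n)%N ->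
  sigma a n <= n%:R * n%:R `^ a.
Proof.
move=> a0 n0.
apply: (@le_trans _ _ (\sum_(d <- divisors n) n%:R `^ a)).
  (* [big_seq] keeps the membership of [d] in the list, which gives [d <= n]; the power is monotone
     in its base since [0 <= a]. *)
  rewrite /sigma big_seq [leRHS]big_seq; apply: ler_sum => d.
  rewrite -dvdn_divisors // => dn.
  by apply: ge0_ler_powR; rewrite ?nnegrE ?ler0n // ler_nat dvdn_leq.
rewrite big_const_seq count_predT iter_addr addr0 -[leLHS]mulr_natl.
by rewrite ler_wpM2r ?powR_ge0 // ler_nat size_divisors_le.
Qed.

Theorem theorem3p10 (R : realType) (a b : R) (ha : 0 < a) (hb : a + 2 < b) :
  ~ exists n : nat, (0 < n)%N /\ strong_alpha a b n.
Proof.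
move=> [n [n0 [_ [u [v [u0 v0 _ sE /andP[le2 leo]]]]]]].
(* The lower bound 2 on the maximum rules out [n = 1], where all powers coincide. *)
have n1 : (1 < n)%N by apply: leq_trans (omega_le n); apply: leq_trans leo.
have vn : (v <= n)%N.
  by apply: leq_trans (omega_le n); apply: leq_trans leo; rewrite leq_maxr.
have nR0 : 0 < n%:R :> R by rewrite ltr0n.
have nb_le : n%:R `^ b <= n%:R `^ (a + 2) :> R.
  have -> : n%:R `^ (a + 2) = n%:R * (n%:R * n%:R `^ a) :> R.
    rewrite powRD; last by rewrite (gt_eqF nR0) implybT.
    by rewrite powR_mulrn ?ler0n // expr2 mulrC mulrA.
  apply: (@le_trans _ _ (u%:R * n%:R `^ b)).
    by rewrite ler_peMl ?powR_ge0 // ler1n.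
  (* Clearing the denominator [v] in [sE], possible as [0 < v]. *)
  have -> : u%:R * n%:R `^ b = v%:R * sigma a n.
    by rewrite sE mulrA mulrCA divff ?mulr1 // pnatr_eq0 -lt0n.
  apply: (@le_trans _ _ (v%:R * (n%:R * n%:R `^ a))).
    by rewrite ler_wpM2l ?ler0n // sigma_le // ltW.
  by rewrite ler_wpM2r ?mulr_ge0 ?powR_ge0 ?ler0n // ler_nat.
(* For a nonzero base, [powR] is the exponential of the exponent times [ln n], and [ln n] is
   positive as [1 < n]; so [hb] gives a strict inequality. *)
have : n%:R `^ (a + 2) < n%:R `^ b :> R
  by rewrite /powR (gt_eqF nR0) ltr_expR ltr_pM2r // ln_gt0 // ltr1n.
by rewrite ltNge nb_le.
Qed.
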